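(* Let $X$ be a diffeological space and let $g$ be a weak Riemannian metric on $X$ that is definite, i.e. there is a generating family $\mathcal{G}$ of the diffeology of $X$ such that $g(P)$ is a positive definite tensor on $U_P$ for every $P\in\mathcal{G}$. Then $g$ is definite in the sense of Iglesias-Zemmour: for every smooth path $\gamma\colon\mathbb{R}\to X$ and $t\in\mathbb{R}$, if $g(\gamma)_t(1,1)=0$, then $\alpha(\gamma)_t(1)=0$ for every differential $1$-form $\alpha\in\Omega^1(X)$.
   Context: A domain is an open subset of some $\mathbb{R}^n$, $n\ge 0$. A diffeology $\mathcal{D}$ on a set $X$ is a set of maps $P\colon U_P\to X$ from domains (called plots) that contains all constant maps from domains, is closed under precomposition with smooth maps between domains, and is local (a map $U\to X$ from a domain whose restrictions to the members of some open cover of $U$ are plots is a plot). A map between diffeological spaces is smooth if its composite with every plot is a plot. Domains carry the standard diffeology of all usual smooth maps from domains. Generating family: a set $\mathcal{G}\subset\mathcal{D}$ such that a map $P\colon U_P\to X$ from a domain is in $\mathcal{D}$ iff every $r\in U_P$ has an open neighborhood $V$ in $U_P$ such that $P|_V$ is constant or $P|_V=Q\circ f$ for some $Q\in\mathcal{G}$ and smooth $f\colon V\to U_Q$. Tangent construction: regard $\mathcal{D}$ as a category whose objects are plots and whose morphisms $P\to Q$ are smooth $h\colon U_P\to U_Q$ with $Q\circ h=P$. Put $T_2(X)=\operatorname{colim}_{P\in\mathcal{D}}(U_P\times\mathbb{R}^{\dim U_P}\times\mathbb{R}^{\dim U_P})$, where $h$ acts by $(r,v,w)\mapsto(h(r),Jh_rv,Jh_rw)$.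 A weak Riemannian metric on $X$ is a map $g\colon T_2(X)\to\mathbb{R}$ such that for every plot $P$, $g(P)_r(v,w):=g([r,v,w]_P)$ is a smooth symmetric covariant $2$-tensor on $U_P$ with $g(P)_r(v,v)\ge 0$. A differential $1$-form $\alpha\in\Omega^1(X)$ is a family $\{\alpha(P)\}_{P\in\mathcal{D}}$ with $\alpha(P)$ a smooth $1$-form on $U_P$ such that $\alpha(P\circ f)=f^*\alpha(P)$ for every plot $P$ and smooth $f\colon V\to U_P$ from a domain $V$. Here $1=(d/dt)_t\in T_t\mathbb{R}$. *)

(* Defs.v *)
From HB Require Import structures.
From Stdlib Require Import Relation_Operators.
From mathcomp Require Import all_boot all_order all_algebra generic_quotient.
From mathcomp Require Import all_classical all_reals all_analysis.

Set Implicit Arguments.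
Unset Strict Implicit.
Unset Printing Implicit Defensive.

Import Order.TTheory GRing.Theory Num.Theory.
Import numFieldNormedType.Exports.

Local Open Scope classical_set_scope.
Local Open Scope ring_scope.

(* On an open subset of a finite-dimensional space, [Ck k] is the usual class
   C^k: every iterated directional derivative of order at most k exists and is
   continuous. *)
Fixpoint Ck (R : realType) (V W : normedModType R) (k : nat) (U : set V)
    (f : V -> W) : Prop :=
  match k with
  | 0 => forall x, U x -> {for x, continuous f}
  | k'.+1 => (forall x, U x -> differentiable f x) /\
             (forall v : V, Ck k' U (fun x => 'D_v f x))
  end.

Record domain (R : realType) := Domain {
  dom_dim : nat;
  dom_set : set 'rV[R]_dom_dim;
  dom_open : open dom_set }.

Definition points (R : realType) (U : domain R) : Type :=
  set_type (@dom_set R U).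
Coercion points : domain >-> Sortclass.

(* A map on a domain only becomes a total map, as the library's notions of
   continuity and differential require, after an extension (by 0); since the
   domain is open, the choice of extension is irrelevant. *)
Definition ext (R : realType) (U : domain R) (W : normedModType R)
    (f : U -> W) : 'rV[R]_(dom_dim U) -> W :=
  valL_ 0 f.

Definition smooth (R : realType) (U : domain R) (W : normedModType R)
    (f : U -> W) : Prop :=
  forall k, Ck k (@dom_set R U) (ext f).

Definition dom_val (R : realType) (U V : domain R) (f : U -> V) :
    U -> 'rV[R]_(dom_dim V) :=
  fun r => val (f r).

Definition smooth_dom (R : realType) (U V : domain R) (f : U -> V) : Prop :=
  smooth (dom_val f).

(* [jac f r v] is (J f_r) v. *)
Definition jac (R : realType) (U V : domain R) (f : U -> V) (r : U) :
    'rV[R]_(dom_dim U) -> 'rV[R]_(dom_dim V) :=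
  'd (ext (dom_val f)) (val r).

Record subdomain (R : realType) (U : domain R) := Subdomain {
  sub_set : set 'rV[R]_(dom_dim U);
  sub_open : open sub_set;
  sub_subset : sub_set `<=` @dom_set R U }.
Arguments sub_open {R U} V : rename.
Arguments sub_subset {R U} V : rename.

Definition sub_domain (R : realType) (U : domain R) (V : subdomain U) :
    domain R := Domain (sub_open V).
Coercion sub_domain : subdomain >-> domain.

Definition dom_incl (R : realType) (U : domain R) (V : subdomain U) (s : V) :
    U :=
  SigSub (mem_set (sub_subset V (val s) (set_mem (valP s)))).

Definition restr (R : realType) (X : Type) (U : domain R) (V : subdomain U)
    (P : U -> X) : V -> X :=
  fun s => P (dom_incl s).
Arguments restr {R X U} V P.

Record diffeology (R : realType) (X : Type) := Diffeology {
  is_plot : forall U : domain R, set (U -> X);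
  plot_cst : forall (U : domain R) (x : X), is_plot (fun _ : U => x);
  plot_comp : forall (U V : domain R) (P : U -> X) (f : V -> U),
    is_plot P -> smooth_dom f -> is_plot (P \o f);
  plot_local : forall (U : domain R) (P : U -> X) (C : set (subdomain U)),
    @dom_set R U `<=` \bigcup_(V in C) sub_set V ->
    (forall V, C V -> is_plot (restr V P)) -> is_plot P }.

Record plot (R : realType) (X : Type) (D : diffeology R X) := Plot {
  plot_dom : domain R;
  plot_map :> plot_dom -> X;
  plotP : is_plot D plot_map }.

Definition pullback_plot (R : realType) (X : Type) (D : diffeology R X)
    (P : plot D) (V : domain R) (f : V -> plot_dom P) (hf : smooth_dom f) :
    plot D :=
  Plot (plot_comp (plotP P) hf).

(* Smoothness for given sets of plots [DX] of X and [DY] of Y. *)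
Definition smooth_map (R : realType) (X Y : Type)
    (DX : forall U : domain R, set (U -> X))
    (DY : forall U : domain R, set (U -> Y)) (f : X -> Y) : Prop :=
  forall (U : domain R) (P : U -> X), DX U P -> DY U (f \o P).

(* The plots of the standard diffeology of the domain W. *)
Definition std_plot (R : realType) (W : domain R) :
    forall U : domain R, set (U -> W) :=
  fun U f => smooth_dom f.

Definition generating (R : realType) (X : Type) (D : diffeology R X)
    (G : set (plot D)) : Prop :=
  forall (U : domain R) (P : U -> X),
    is_plot D P <->
    (forall r : U, exists V : subdomain U, sub_set V (val r) /\
      ((exists x : X, forall s : V, restr V P s = x) \/
       (exists2 Q : plot D, G Q &
        exists2 f : V -> plot_dom Q, smooth_dom f & restr V P = Q \o f))).

(* T_2(X): the colimit is the quotient of the disjoint union over all plots by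
   the equivalence relation generated by the action of the morphisms. *)

Record tan2_pre (R : realType) (X : Type) (D : diffeology R X) := Tan2Pre {
  tan2_plot : plot D;
  tan2_base : plot_dom tan2_plot;
  tan2_fst : 'rV[R]_(dom_dim (plot_dom tan2_plot));
  tan2_snd : 'rV[R]_(dom_dim (plot_dom tan2_plot)) }.

Inductive tan2_step (R : realType) (X : Type) (D : diffeology R X) :
    tan2_pre D -> tan2_pre D -> Prop :=
  Tan2Step (P Q : plot D) (h : plot_dom P -> plot_dom Q) :
    smooth_dom h -> Q \o h = P :> (plot_dom P -> X) ->
    forall (r : plot_dom P) (v w : 'rV[R]_(dom_dim (plot_dom P))),
    tan2_step (Tan2Pre r v w) (Tan2Pre (h r) (jac h r v) (jac h r w)).

Definition tan2_eq (R : realType) (X : Type) (D : diffeology R X) :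
    rel {classic tan2_pre D} :=
  fun p q => `[< clos_refl_sym_trans (tan2_pre D) (@tan2_step R X D) p q >].

Lemma tan2_eq_equiv (R : realType) (X : Type) (D : diffeology R X) :
  equiv_class_of (@tan2_eq R X D).
Proof.
split=> [p|p q|q p s].
- by apply/asboolP; exact: rst_refl.
- by apply/asboolP/asboolP => pq; exact: rst_sym.
- by move=> /asboolP pq /asboolP qs; apply/asboolP; apply: rst_trans pq qs.
Qed.

Canonical tan2_equiv_rel (R : realType) (X : Type) (D : diffeology R X) :=
  EquivRelPack (@tan2_eq_equiv R X D).

Definition T2 (R : realType) (X : Type) (D : diffeology R X) : Type :=
  {eq_quot @tan2_eq R X D}%qT.

(* The class [r, v, w]_P. *)
Definition tan2 (R : realType) (X : Type) (D : diffeology R X) (P : plot D)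
    (r : plot_dom P) (v w : 'rV[R]_(dom_dim (plot_dom P))) : T2 D :=
  (\pi_({eq_quot @tan2_eq R X D}) (Tan2Pre r v w : {classic tan2_pre D}))%qT.

(* A 2-tensor is smooth when its coefficients are, i.e. when its values on
   pairs of constant vectors are smooth functions of the base point. *)
Definition smooth_sym_tensor (R : realType) (U : domain R)
    (tau : U -> 'rV[R]_(dom_dim U) -> 'rV[R]_(dom_dim U) -> R) : Prop :=
  [/\ forall r v, scalar (tau r v),
      forall r w, scalar (tau r ^~ w),
      forall r v w, tau r v w = tau r w v
    & forall v w, smooth (fun r => tau r v w)].

Record weak_riemannian (R : realType) (X : Type) (D : diffeology R X) :=
  WeakRiemannian {
    metric :> T2 D -> R;
    metric_tensor : forall P : plot D,
      smooth_sym_tensor (fun r v w => metric (@tan2 R X D P r v w));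
    metric_ge0 : forall (P : plot D) r v, 0 <= metric (@tan2 R X D P r v v) }.

(* g(P)_r(v, w) *)
Definition metric_at (R : realType) (X : Type) (D : diffeology R X)
    (g : weak_riemannian D) (P : plot D) (r : plot_dom P)
    (v w : 'rV[R]_(dom_dim (plot_dom P))) : R :=
  g (tan2 r v w).

Definition definite (R : realType) (X : Type) (D : diffeology R X)
    (g : weak_riemannian D) : Prop :=
  exists G : set (plot D), generating G /\
    forall P, G P -> forall (r : plot_dom P) v, v != 0 -> 0 < metric_at g r v v.

Record form1 (R : realType) (U : domain R) := Form1 {
  form1_at :> U -> {scalar 'rV[R]_(dom_dim U)};
  form1_smooth : forall v, smooth (fun r => form1_at r v) }.

Record Omega1 (R : realType) (X : Type) (D : diffeology R X) := OmegaOne {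
  omega1 :> forall P : plot D, form1 (plot_dom P);
  omega1_pullback : forall (P : plot D) (V : domain R) (f : V -> plot_dom P)
      (hf : smooth_dom f) (r : V) (v : 'rV[R]_(dom_dim V)),
    omega1 (pullback_plot hf) r v = omega1 P (f r) (jac f r v) }.

Definition line (R : realType) : domain R := @Domain R 1 setT openT.

(* The tangent vector d/dt. *)
Definition ddt (R : realType) : 'rV[R]_(dom_dim (line R)) := const_mx 1.

Definition smooth_path (R : realType) (X : Type) (D : diffeology R X)
    (gamma : line R -> X) : Prop :=
  smooth_map (@std_plot R (line R)) (@is_plot R X D) gamma.

Lemma Ck_cst (R : realType) (V W : normedModType R) (k : nat) (U : set V)
    (a : W) : Ck k U (fun=> a).
Proof.
elim: k a => [|k IHk] a /=; first by move=> x _; exact: cst_continuous.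
split=> [x _|v]; first exact: differentiable_cst.
suff -> : (fun x => 'D_v (fun=> a) x) = (fun=> 0 : W) by exact: IHk.
by apply/funext => x; exact: derive_cst.
Qed.

Lemma smooth_line_id (R : realType) : smooth_dom (@id (line R)).
Proof.
have extE : ext (dom_val (@id (line R))) = id.
  apply/funext => x; rewrite /ext /valL_ oinv_set_val /= insubT ?inE //.
case=> [|k]; rewrite extE /=; first by move=> x _; exact: cvg_id.
split=> [x _|v]; first exact: ex_diff.
suff -> : (fun x => 'D_v id x) = (fun=> v) by exact: Ck_cst.
by apply/funext => x; exact: derive_id.
Qed.

Lemma smooth_path_plot (R : realType) (X : Type) (D : diffeology R X)
    (gamma : line R -> X) : smooth_path D gamma -> is_plot D gamma.
Proof. by move=> /(_ _ _ (@smooth_line_id R)). Qed.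

Definition path_plot (R : realType) (X : Type) (D : diffeology R X)
    (gamma : line R -> X) (hgamma : smooth_path D gamma) : plot D :=
  Plot (smooth_path_plot hgamma).

Definition definite_IZ (R : realType) (X : Type) (D : diffeology R X)
    (g : weak_riemannian D) : Prop :=
  forall (gamma : line R -> X) (hgamma : smooth_path D gamma) (t : line R),
    @metric_at R X D g (path_plot hgamma) t (ddt R) (ddt R) = 0 ->
    forall alpha : Omega1 D, alpha (path_plot hgamma) t (ddt R) = 0.

(* Main.v *)
(* Near t the path is constant or factors as Q \o f with Q in the generating
   family. In the second case g(Q) vanishes on J f_t(1), so J f_t(1) = 0 by
   positivity, and the value of the form at 1 is that of alpha(Q) at J f_t(1).
   Passing from the path to its restriction near t changes neither g nor alpha,
   as the inclusion of an open subset has the identity as differential. *)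
From Stdlib Require Import Relation_Operators.
Require Import Defs.
From mathcomp Require Import all_boot all_order all_algebra.
From mathcomp Require Import all_classical all_reals all_analysis.

Set Implicit Arguments.
Unset Strict Implicit.
Unset Printing Implicit Defensive.

Import Order.TTheory GRing.Theory Num.Theory.
Import numFieldNormedType.Exports.

Local Open Scope classical_set_scope.
Local Open Scope ring_scope.

(** A differential is determined by the first-order expansion at [x], which only sees the germ
    there: the expansion of [f] also serves for [g], and uniqueness of the differential
    concludes. *)
Lemma near_eq_is_diff (R : realType) (V W : normedModType R) (x : V)
    (f g df : V -> W) :
  (\near x, f x = g x) -> is_diff x f df -> is_diff x g df.
Proof.
move=> fg isdf; have fgx : f x = g x := nbhs_singleton fg.
have [fd dfE] := isdf; move: (fd) => /diff_locallyP [dfc fo].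
have go : g \o shift x = cst (g x) + 'd f x +o_ (0 : V) id.
  apply/eqaddoP => e e0; move/eqaddoP: fo => /(_ e e0).
  have : \forall y \near (0 : V), f (y + x) = g (y + x).
    by move: fg; rewrite (near_shift 0); apply: filterS => y /=; rewrite subr0.
  by apply: filterS2 => y fgy; rewrite /= !fctE /= fgy fgx.
have dgE : 'd g x = 'd f x :> (V -> W) by exact: diff_unique.
split; last by rewrite dgE.
by apply/diff_locallyP; rewrite dgE.
Qed.

Lemma near_open (T : topologicalType) (U : set T) (P : T -> Prop) (x : T) :
  open U -> U x -> (forall y, U y -> P y) -> \near x, P x.
Proof. by move=> oU Ux UP; exact: filterS UP (open_nbhs_nbhs (conj oU Ux)). Qed.

(** Openness turns agreement on [U] into agreement near each of its points, so directional
    derivatives agree on [U] as well and the induction goes through. *)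
Lemma eq_Ck (R : realType) (V W : normedModType R) (k : nat) (U : set V)
    (f g : V -> W) :
  open U -> (forall x, U x -> f x = g x) -> Ck k U f -> Ck k U g.
Proof.
move=> oU; elim: k f g => [|k IHk] f g fg /=.
  move=> fc x Ux; have fgn := near_open oU Ux fg.
  suff : g @ x --> f x by rewrite (fg x Ux).
  by apply: cvg_trans (fc x Ux); exact: near_eq_cvg.
move=> [fd fD]; split=> [x Ux|v].
  have fgn := near_open oU Ux fg.
  by have [] := near_eq_is_diff fgn (differentiableP (fd x Ux)).
apply: IHk (fD v) => x Ux; have fgn := near_open oU Ux fg.
exact: near_eq_derive.
Qed.

Lemma Ck_id (R : realType) (V : normedModType R) (k : nat) (U : set V) :
  Ck k U (@id V).
Proof.
case: k => [|k] /=; first by move=> x _; exact: cvg_id.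
split=> [x _|v]; first exact: ex_diff.
suff -> : (fun x => 'D_v id x) = (fun=> v) by exact: Ck_cst.
by apply/funext => x; exact: derive_id.
Qed.

Lemma ext_val (R : realType) (U : domain R) (W : normedModType R) (f : U -> W)
    (r : U) : ext f (val r) = f r.
Proof. by rewrite /ext /valL_ oinv_set_val /= valK. Qed.

Lemma eq_ext (R : realType) (U : domain R) (W : normedModType R) (f : U -> W)
    (h : 'rV[R]_(dom_dim U) -> W) :
  (forall r, f r = h (val r)) -> forall x, @dom_set R U x -> h x = ext f x.
Proof.
move=> fh x Ux; pose r : U := SigSub (mem_set Ux).
by rewrite -[x]/(val r) ext_val fh.
Qed.

Lemma dom_setP (R : realType) (U : domain R) (r : U) : @dom_set R U (val r).
Proof. exact: set_mem (valP r). Qed.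

(** Replaces the extension by 0, awkward to differentiate, by any convenient total map such as a
    constant or the identity; [jac_eq] does the same for differentials. *)
Lemma eq_smooth (R : realType) (U : domain R) (W : normedModType R) (f : U -> W)
    (h : 'rV[R]_(dom_dim U) -> W) :
  (forall k, Ck k (@dom_set R U) h) -> (forall r, f r = h (val r)) -> smooth f.
Proof. by move=> hC fh k; exact: eq_Ck (@dom_open R U) (eq_ext fh) (hC k). Qed.

Lemma jac_eq (R : realType) (U V : domain R) (f : U -> V) (r : U)
    (h dh : 'rV[R]_(dom_dim U) -> 'rV[R]_(dom_dim V)) :
  (forall s, val (f s) = h (val s)) -> is_diff (val r) h dh -> jac f r = dh.
Proof.
move=> fh dhr; have fhn := near_open (@dom_open R U) (dom_setP r) (eq_ext fh).
by rewrite /jac; have [_ ->] := near_eq_is_diff fhn dhr.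
Qed.

Lemma smooth_dom_cst (R : realType) (U V : domain R) (s : V) :
  smooth_dom (fun _ : U => s).
Proof. by apply: (@eq_smooth _ _ _ _ (cst (val s))) => // k; exact: Ck_cst. Qed.

Lemma jac_cst (R : realType) (U V : domain R) (s : V) (r : U) :
  jac (fun _ : U => s) r = 0.
Proof. exact: (@jac_eq _ _ _ _ _ (cst (val s))). Qed.

Lemma smooth_dom_incl (R : realType) (U : domain R) (V : subdomain U) :
  smooth_dom (@dom_incl R U V).
Proof. by apply: (@eq_smooth _ _ _ _ id) => // k; exact: Ck_id. Qed.

Lemma jac_incl (R : realType) (U : domain R) (V : subdomain U) (r : V) :
  jac (@dom_incl R U V) r = id.
Proof. exact: (@jac_eq _ _ _ _ _ id). Qed.

Lemma tan2_morph (R : realType) (X : Type) (D : diffeology R X) (P Q : plot D)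
    (h : plot_dom P -> plot_dom Q) (r : plot_dom P)
    (v w : 'rV[R]_(dom_dim (plot_dom P))) :
  smooth_dom h -> Q \o h = P :> (plot_dom P -> X) ->
  tan2 r v w = tan2 (h r) (jac h r v) (jac h r w).
Proof.
move=> hs QhP; rewrite /tan2; apply/eqmodP/asboolP; apply: rst_step.
exact: Tan2Step.
Qed.
Arguments tan2_morph {R X D} P Q {h} r v w.

(** A plot carries its membership proof, so equal maps give equal plots only through proof
    irrelevance. *)
Lemma omega1_eq (R : realType) (X : Type) (D : diffeology R X)
    (alpha : Omega1 D) (U : domain R) (P Q : U -> X) (hP : is_plot D P)
    (hQ : is_plot D Q) (r : U) v :
  P = Q -> alpha (Plot hP) r v = alpha (Plot hQ) r v.
Proof. by move=> PQ; subst Q; rewrite (Prop_irrelevance hP hQ). Qed.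

(** Counterpart for forms of [tan2_morph]: the pullback of [Q] along [h] has the same underlying map
    as [P]. *)
Lemma omega1_morph (R : realType) (X : Type) (D : diffeology R X)
    (alpha : Omega1 D) (P Q : plot D) (h : plot_dom P -> plot_dom Q)
    (r : plot_dom P) (v : 'rV[R]_(dom_dim (plot_dom P))) :
  smooth_dom h -> Q \o h = P :> (plot_dom P -> X) ->
  alpha P r v = alpha Q (h r) (jac h r v).
Proof.
case: P h r v => U P hP /= h r v hs QhP.
by rewrite -(omega1_pullback alpha hs); exact: omega1_eq.
Qed.
Arguments omega1_morph {R X D} alpha P Q {h} r v.

Theorem proposition3p10 (R : realType) (X : Type) (D : diffeology R X)
    (g : weak_riemannian D) :
  definite g -> definite_IZ g.
Proof.
move=> [G [genG gG]] gamma hgamma t gt0 alpha.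
have [V [Vt Hcase]] := (genG _ gamma).1 (smooth_path_plot hgamma) t.
pose s : V := SigSub (mem_set Vt).
(* The restriction of [gamma] to [V], built as a pullback so that the inclusion is a morphism to
   [gamma] by computation. *)
pose P : plot D := pullback_plot (P := path_plot hgamma) (@smooth_dom_incl R _ V).
have st : dom_incl s = t by exact: val_inj.
have gammaP : path_plot hgamma \o @dom_incl R _ V = P by [].
have incl_smooth := @smooth_dom_incl R _ V.
have alphaE :=
  omega1_morph alpha P (path_plot hgamma) s (ddt R) incl_smooth gammaP.
have gE := tan2_morph P (path_plot hgamma) s (ddt R) (ddt R) incl_smooth gammaP.
move: alphaE gE; rewrite jac_incl st => <- gE.
case: Hcase => [[x Px]|[Q GQ [f fs fQ]]].
  (* A constant plot factors through a constant endomap of its domain, whose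
     differential vanishes. *)
  have cP : P \o (fun _ : V => s) = P.
    by apply/funext => y; rewrite /= [LHS]Px; exact/esym/Px.
  rewrite (omega1_morph alpha P P s _ (@smooth_dom_cst R V V s) cP).
  by rewrite jac_cst linear0.
have QfP : Q \o f = P by rewrite -fQ.
rewrite (omega1_morph alpha P Q s _ fs QfP).
suff -> : jac f s (ddt R) = 0 by rewrite linear0.
apply/eqP/contraT => /(gG _ GQ (f s)).
(* In [T2 D] the pushed-forward class over [Q] is that of [s] over [P], hence that of [t] over
   [gamma], where [g] vanishes: positivity would give 0 < 0. *)
by rewrite /metric_at -(tan2_morph P Q s _ _ fs QfP) gE [g _]gt0 ltxx.
Qed.
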